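(* Let $Z\in\mathbb S^n$ be nonsingular with eigenvalue decomposition $Z=Q\operatorname{diag}(\lambda_1,\dots,\lambda_r,\lambda_{r+1},\dots,\lambda_n)Q^\top$, where $\lambda_1\ge\dots\ge\lambda_r>0>\lambda_{r+1}\ge\dots\ge\lambda_n$ and $Q$ is orthogonal. Then there exist positive constants $C_{\mathrm{EB}}$ and $\alpha_{\mathrm{EB}}$ such that for all $H\in\mathbb S^n$ with $\|H\|_2\le C_{\mathrm{EB}}$, $$\big\|\Pi_{\mathbb S^n_+}(Z+H)-\Pi_{\mathbb S^n_+}(Z)-Q(\Omega\circ\tilde H)Q^\top\big\|_2\le\alpha_{\mathrm{EB}}\,\|\tilde H_O\|_2\,\|H\|_2,$$ where $\tilde H:=Q^\top HQ=\begin{pmatrix}\tilde H_X&\tilde H_O^\top\\ \tilde H_O&\tilde H_S\end{pmatrix}$ with $\tilde H_X\in\mathbb S^r$, $\tilde H_S\in\mathbb S^{n-r}$, $\tilde H_O\in\mathbb R^{(n-r)\times r}$.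
   Context: $\mathbb S^n$ is the space of real symmetric $n\times n$ matrices, $\Pi_{\mathbb S^n_+}$ the Frobenius-orthogonal projection onto the positive semidefinite cone, $\|\cdot\|_2$ the spectral norm, $\circ$ the Hadamard (entrywise) product. $\Omega=\begin{pmatrix}E_r&\Theta^\top\\ \Theta&0\end{pmatrix}$ where $E_r$ is the $r\times r$ all-ones matrix and $\Theta\in\mathbb R^{(n-r)\times r}$ has entries $\Theta_{ij}=\lambda_j/(\lambda_j-\lambda_{i+r})$ for $i\in[n-r]$, $j\in[r]$. *)

(* Defs.v *)
From HB Require Import structures.
From mathcomp Require Import all_boot all_order all_algebra.
From mathcomp Require Import boolp classical_sets reals.
Set Implicit Arguments. Unset Strict Implicit. Unset Printing Implicit Defensive.
Import Order.TTheory GRing.Theory Num.Theory.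
Local Open Scope ring_scope.
Local Open Scope classical_set_scope.

Section Defs.
Variable R : realType.

Definition symmat {n : nat} (A : 'M[R]_n) : Prop := A^T = A.

Definition psd {n : nat} (A : 'M[R]_n) : Prop :=
  symmat A /\ forall x : 'cV[R]_n, 0 <= (x^T *m A *m x) 0 0.

Definition frob2 {m n : nat} (A : 'M[R]_(m, n)) : R :=
  \sum_(i < m) \sum_(j < n) A i j ^+ 2.

(* Frobenius-orthogonal projection onto the PSD cone: the PSD matrix
   closest to Z in Frobenius norm (it exists and is unique). *)
Definition is_psd_proj {n : nat} (Z P : 'M[R]_n) : Prop :=
  psd P /\ forall Y : 'M[R]_n, psd Y -> frob2 (Z - P) <= frob2 (Z - Y).

Definition psd_proj {n : nat} (Z : 'M[R]_n) : 'M[R]_n :=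
  xget 0 [set P | is_psd_proj Z P].

Definition vnorm {n : nat} (x : 'cV[R]_n) : R :=
  Num.sqrt (\sum_(i < n) x i 0 ^+ 2).

Definition specnorm {m n : nat} (A : 'M[R]_(m, n)) : R :=
  sup [set vnorm (A *m x) | x in [set x : 'cV[R]_n | vnorm x = 1]].

Definition hadamard {m n : nat} (A B : 'M[R]_(m, n)) : 'M[R]_(m, n) :=
  \matrix_(i, j) (A i j * B i j).

Definition Theta {r s : nat} (lam : 'rV[R]_(r + s)) : 'M[R]_(s, r) :=
  \matrix_(i < s, j < r)
     (lam 0 (lshift s j) / (lam 0 (lshift s j) - lam 0 (rshift r i))).

Definition Omega {r s : nat} (lam : 'rV[R]_(r + s)) : 'M[R]_(r + s) :=
  block_mx (const_mx 1) (Theta lam)^T (Theta lam) 0.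

End Defs.

(* Main.v *)
Require Import Defs.
From HB Require Import structures.
From mathcomp Require Import all_boot all_order all_algebra.
From mathcomp Require Import boolp classical_sets reals.
From mathcomp Require Import interval_inference topology normedtype sequences.
From mathcomp Require Import ring lra.
Import Order.TTheory GRing.Theory Num.Theory.
Import numFieldNormedType.Exports.
Local Open Scope ring_scope.

Set Implicit Arguments.
Unset Strict Implicit.
Unset Printing Implicit Defensive.

(* The projection [P] of [M] onto the PSD cone satisfies [P (P - M) = 0] and
   depends on [M] in a nonexpansive way. In the eigenbasis of [Z], put
   [M = diag lam + K] and let [X], [B] be the off-diagonal blocks of [P], [K].
   Since [P] is close to the positive part of [diag lam], the off-diagonal
   block of [(P - M) P = 0] is a perturbed Sylvester equation with gap
   [lam_j - lam_(r+i)], so [X] is of order [B] and equals [Theta o B] up to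
   O(|B| |K|). The diagonal blocks of the same identity express the remaining
   errors [P11 - diag lam1 - K11] and [P22] through products [X^T (X - B)] and
   [(X - B) X^T], which are O(|B| |K|) as well. All estimates use the entrywise
   l1 norm, equivalent to the spectral norm. *)

(** * Comparison of the entrywise l1, Frobenius and spectral norms *)

Section EntrywiseNorm.
Variable R : realType.

(** This norm is submultiplicative, invariant under transposition and additive over blocks, so block
    estimates simply add up. *)
Definition l1norm {m n : nat} (A : 'M[R]_(m, n)) : R :=
  \sum_(i < m) \sum_(j < n) `|A i j|.

Lemma l1norm_ge0 m n (A : 'M[R]_(m, n)) : 0 <= l1norm A.
Proof. by apply: sumr_ge0 => i _; apply: sumr_ge0. Qed.

Lemma l1norm_row m n (A : 'M[R]_(m, n)) i : \sum_j `|A i j| <= l1norm A.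
Proof.
rewrite /l1norm (bigD1 i) //= lerDl.
by apply: sumr_ge0 => k _; apply: sumr_ge0.
Qed.

Lemma l1norm_entry m n (A : 'M[R]_(m, n)) i j : `|A i j| <= l1norm A.
Proof.
by apply: le_trans (l1norm_row A i); rewrite (bigD1 j) //= lerDl sumr_ge0.
Qed.

Lemma l1normD m n (A B : 'M[R]_(m, n)) : l1norm (A + B) <= l1norm A + l1norm B.
Proof.
rewrite /l1norm -big_split /=; apply: ler_sum => i _.
rewrite -big_split /=; apply: ler_sum => j _.
by rewrite mxE ler_normD.
Qed.

Lemma l1normN m n (A : 'M[R]_(m, n)) : l1norm (- A) = l1norm A.
Proof. by apply: eq_bigr => i _; apply: eq_bigr => j _; rewrite mxE normrN. Qed.

Lemma l1normB m n (A B : 'M[R]_(m, n)) : l1norm (A - B) <= l1norm A + l1norm B.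
Proof. by rewrite -(l1normN B) l1normD. Qed.

Lemma l1norm_tr m n (A : 'M[R]_(m, n)) : l1norm A^T = l1norm A.
Proof.
by rewrite /l1norm exchange_big; do 2![apply: eq_bigr => ? _]; rewrite mxE.
Qed.

Lemma l1normM m n p (A : 'M[R]_(m, n)) (B : 'M[R]_(n, p)) :
  l1norm (A *m B) <= l1norm A * l1norm B.
Proof.
rewrite /l1norm big_distrl /=; apply: ler_sum => i _.
apply: (@le_trans _ _ (\sum_k \sum_j `|A i j| * `|B j k|)).
  apply: ler_sum => k _; rewrite mxE; apply: le_trans (ler_norm_sum _ _ _) _.
  by apply: ler_sum => j _; rewrite normrM.
rewrite exchange_big big_distrl /=; apply: ler_sum => j _.
by rewrite -big_distrr /= ler_wpM2l // l1norm_row.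
Qed.

Lemma l1norm_block m1 m2 n1 n2 (A : 'M[R]_(m1, n1)) (B : 'M_(m1, n2))
    (C : 'M_(m2, n1)) (D : 'M_(m2, n2)) :
  l1norm (block_mx A B C D) = l1norm A + l1norm B + (l1norm C + l1norm D).
Proof.
rewrite /l1norm big_split_ord /= -!big_split /=; congr (_ + _);
  apply: eq_bigr => i _; rewrite big_split_ord /=; congr (_ + _);
  by apply: eq_bigr => j _;
  rewrite (block_mxEul, block_mxEur, block_mxEdl, block_mxEdr).
Qed.

Lemma frob2_ge0 m n (A : 'M[R]_(m, n)) : 0 <= frob2 A.
Proof. by do 2![apply: sumr_ge0 => ? _]; rewrite sqr_ge0. Qed.

Lemma frob2_entry m n (A : 'M[R]_(m, n)) i j : A i j ^+ 2 <= frob2 A.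
Proof.
rewrite /frob2 (bigD1 i) //= (bigD1 j) //= -addrA lerDl addr_ge0 //.
  by apply: sumr_ge0 => ? _; rewrite sqr_ge0.
by do 2![apply: sumr_ge0 => ? _]; rewrite sqr_ge0.
Qed.

Lemma frob2_eq0 m n (A : 'M[R]_(m, n)) : frob2 A <= 0 -> A = 0.
Proof.
move=> A0; apply/matrixP => i j; rewrite mxE; apply/eqP.
by rewrite -sqrf_eq0 eq_le sqr_ge0 (le_trans (frob2_entry A i j)).
Qed.

Lemma frob2_le_l1norm m n (A : 'M[R]_(m, n)) : frob2 A <= l1norm A ^+ 2.
Proof.
rewrite expr2 {1}/l1norm big_distrl /=; apply: ler_sum => i _.
rewrite big_distrl /=; apply: ler_sum => j _.
by rewrite -real_normK ?num_real // expr2 ler_wpM2l // l1norm_entry.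
Qed.

Lemma vnorm_le_l1norm n (x : 'cV[R]_n) : vnorm x <= l1norm x.
Proof.
rewrite -[leRHS]ger0_norm ?l1norm_ge0 // -sqrtr_sqr ler_sqrt ?sqr_ge0 //.
apply: le_trans (frob2_le_l1norm x); apply: ler_sum => i _.
by rewrite big_ord1.
Qed.

Lemma vnorm_entry n (x : 'cV[R]_n) i : `|x i 0| <= vnorm x.
Proof.
rewrite -sqrtr_sqr ler_sqrt; last by apply: sumr_ge0 => ? _; rewrite sqr_ge0.
rewrite (bigD1 i) //= lerDl; by apply: sumr_ge0 => ? _; rewrite sqr_ge0.
Qed.

Lemma vnorm_mul_le m n (A : 'M[R]_(m, n)) x :
  vnorm x = 1 -> vnorm (A *m x) <= l1norm A.
Proof.
move=> x1; apply: le_trans (vnorm_le_l1norm _) _.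
apply: ler_sum => i _; rewrite big_ord1 mxE.
apply: le_trans (ler_norm_sum _ _ _) _; apply: ler_sum => j _.
by rewrite normrM -[leRHS]mulr1 ler_wpM2l // -x1 vnorm_entry.
Qed.

Lemma specnorm_le_l1norm m n (A : 'M[R]_(m, n)) : specnorm A <= l1norm A.
Proof.
rewrite /specnorm; set S := [set _ | _ in _]%classic.
(* Without columns there is no unit vector, and the supremum of the empty set is 0. *)
have [/nonemptyPn ->|S0] := pselect (~ (S !=set0)%classic).
  by rewrite sup0 l1norm_ge0.
apply: ge_sup; first exact: contrapT.
by move=> _ [x x1 <-]; apply: vnorm_mul_le.
Qed.

Lemma specnorm_ge0 m n (A : 'M[R]_(m, n)) : 0 <= specnorm A.
Proof.
rewrite /specnorm; set S := [set _ | _ in _]%classic.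
have [/nonemptyPn ->|/contrapT [y Sy]] := pselect (~ (S !=set0)%classic).
  by rewrite sup0.
have y0 : 0 <= y by case: Sy => x _ <-; apply: sqrtr_ge0.
apply: le_trans y0 _; apply: ub_le_sup => //.
by exists (l1norm A) => _ [x x1 <-]; apply: vnorm_mul_le.
Qed.

(** The entry is a coordinate of the image of the [j]-th basis vector, which is a unit vector. *)
Lemma entry_le_specnorm m n (A : 'M[R]_(m, n)) i j : `|A i j| <= specnorm A.
Proof.
have e1 : vnorm (delta_mx j 0 : 'cV[R]_n) = 1.
  rewrite /vnorm (bigD1 j) //= big1 ?mxE ?eqxx ?addr0 ?expr1n ?sqrtr1 // => k kj.
  by rewrite mxE (negPf kj) expr0n.
apply: (@le_trans _ _ (vnorm (A *m delta_mx j 0))).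
  by rewrite -colE; have := vnorm_entry (col j A) i; rewrite mxE.
apply: ub_le_sup; last by exists (delta_mx j 0).
by exists (l1norm A) => _ [x x1 <-]; apply: vnorm_mul_le.
Qed.

Lemma l1norm_le_specnorm m n (A : 'M[R]_(m, n)) :
  l1norm A <= (m * n)%:R * specnorm A.
Proof.
apply: (@le_trans _ _ (\sum_(i < m) \sum_(j < n) specnorm A)).
  by do 2![apply: ler_sum => ? _]; apply: entry_le_specnorm.
by rewrite !sumr_const !card_ord -mulrnA mulr_natl mulnC.
Qed.

End EntrywiseNorm.

(** * Optimality conditions for the projection onto the PSD cone *)

Section Projection.
Variable R : realType.

Definition frobdot {m n : nat} (A B : 'M[R]_(m, n)) : R := \tr (A^T *m B).

Lemma frobdotC m n (A B : 'M[R]_(m, n)) : frobdot A B = frobdot B A.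
Proof. by rewrite /frobdot -mxtrace_tr trmx_mul trmxK. Qed.

Lemma frobdotDr m n (A B C : 'M[R]_(m, n)) :
  frobdot A (B + C) = frobdot A B + frobdot A C.
Proof. by rewrite /frobdot mulmxDr mxtraceD. Qed.

Lemma frobdotZr m n (A B : 'M[R]_(m, n)) t :
  frobdot A (t *: B) = t * frobdot A B.
Proof. by rewrite /frobdot -scalemxAr mxtraceZ. Qed.

Lemma frobdotNr m n (A B : 'M[R]_(m, n)) : frobdot A (- B) = - frobdot A B.
Proof. by rewrite -scaleN1r frobdotZr mulN1r. Qed.

Lemma frob2E m n (A : 'M[R]_(m, n)) : frob2 A = frobdot A A.
Proof.
rewrite /frob2 /frobdot /mxtrace exchange_big; apply: eq_bigr => j _.
by rewrite mxE; apply: eq_bigr => i _; rewrite mxE expr2.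
Qed.

Lemma frob2D m n (A B : 'M[R]_(m, n)) :
  frob2 (A + B) = frob2 A + 2 * frobdot A B + frob2 B.
Proof.
rewrite !frob2E frobdotDr !(frobdotC (A + B)) !frobdotDr (frobdotC B A).
ring.
Qed.

Lemma frob2Z m n (A : 'M[R]_(m, n)) t : frob2 (t *: A) = t ^+ 2 * frob2 A.
Proof. by rewrite !frob2E frobdotZr frobdotC frobdotZr; ring. Qed.

Lemma frob2N m n (A : 'M[R]_(m, n)) : frob2 (- A) = frob2 A.
Proof. by rewrite -scaleN1r frob2Z; ring. Qed.

Lemma psd0 n : psd (0 : 'M[R]_n).
Proof.
split; first by rewrite /symmat trmx0.
by move=> x; rewrite mulmx0 mul0mx mxE.
Qed.

Lemma psdD n (A B : 'M[R]_n) : psd A -> psd B -> psd (A + B).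
Proof.
move=> [sA pA] [sB pB]; split; first by rewrite /symmat raddfD /= sA sB.
by move=> x; rewrite mulmxDr mulmxDl mxE addr_ge0.
Qed.

Lemma psdZ n (A : 'M[R]_n) t : 0 <= t -> psd A -> psd (t *: A).
Proof.
move=> t0 [sA pA]; split; first by rewrite /symmat linearZ /= sA.
by move=> x; rewrite -scalemxAr -scalemxAl mxE mulr_ge0.
Qed.

Lemma psd_congr m n (A : 'M[R]_n) (S : 'M_(m, n)) : psd A -> psd (S *m A *m S^T).
Proof.
move=> [sA pA]; split; first by rewrite /symmat !trmx_mul trmxK sA mulmxA.
move=> x; rewrite !mulmxA -(trmxK S) -trmx_mul trmxK -mulmxA; exact: pA.
Qed.

Lemma psd_diag n (d : 'rV[R]_n) : (forall i, 0 <= d 0 i) -> psd (diag_mx d).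
Proof.
move=> d0; split; first by rewrite /symmat tr_diag_mx.
move=> x; rewrite mul_mx_diag mxE; apply: sumr_ge0 => i _.
by rewrite !mxE mulrAC mulr_ge0 // -expr2 sqr_ge0.
Qed.

Lemma psd_diag_ge0 n (A : 'M[R]_n) i : psd A -> 0 <= A i i.
Proof.
by move=> [_ /(_ (delta_mx i 0))]; rewrite trmx_delta -rowE -colE !mxE.
Qed.

(** Turns minimality along a curve into a first-order condition: for small [t] the linear term
    dominates. *)
Lemma first_order_ge0 (a c : R) :
  (forall t, 0 < t -> t <= 1 -> 0 <= a * t + c * t ^+ 2) -> 0 <= a.
Proof.
move=> h; rewrite leNgt; apply/negP => a0.
(* With this [t], [a + |c| t = a t], which is negative. *)
pose t := - a / (`|c| - a).
have c0 := normr_ge0 c.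
have d0 : 0 < `|c| - a by lra.
have t0 : 0 < t by rewrite divr_gt0 // oppr_gt0.
have t1 : t <= 1 by rewrite ler_pdivrMr // mul1r; lra.
have := h t t0 t1.
have -> : a * t + c * t ^+ 2 = (a + c * t) * t by ring.
rewrite pmulr_lge0 //.
have : c * t <= `|c| * t by rewrite ler_pM2r // ler_norm.
have : t * (`|c| - a) = - a by rewrite /t divfK // gt_eqF.
nra.
Qed.

(** The segment from [P] to [Y] stays in the convex cone, so the derivative of the squared distance
    at [P] towards [Y] is nonnegative. *)
Lemma psd_proj_variational n (M P Y : 'M[R]_n) :
  is_psd_proj M P -> psd Y -> 0 <= frobdot (P - M) (Y - P).
Proof.
move=> [pP minP] pY.
suff: 0 <= 2 * frobdot (P - M) (Y - P) by lra.
apply: (@first_order_ge0 _ (frob2 (Y - P))) => t t0 t1.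
have: psd ((1 - t) *: P + t *: Y) by apply: psdD; apply: psdZ => //; lra.
move=> /minP; rewrite -(frob2N (M - P)) -(frob2N (M - (_ + _))).
have -> : - (M - ((1 - t) *: P + t *: Y)) = (P - M) + t *: (Y - P).
  by apply/matrixP => i j; rewrite !mxE; ring.
rewrite opprB (frob2D (P - M)) frob2Z frobdotZr; lra.
Qed.

(** Adding the variational inequalities of [P] and [P'], each tested at the other point, gives
    [|P - P'|^2 <= <M - M', P - P'>]. Expanding the square of [(M - M') - (P - P')] replaces
    Cauchy-Schwarz. *)
Lemma psd_proj_nonexpansive n (M M' P P' : 'M[R]_n) :
  is_psd_proj M P -> is_psd_proj M' P' -> frob2 (P - P') <= frob2 (M - M').
Proof.
move=> hP hP'.
have := psd_proj_variational hP hP'.1.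
have := psd_proj_variational hP' hP.1.
have := frob2_ge0 ((M - M') - (P - P')).
rewrite -(opprB P P') frobdotNr frob2D frob2N frobdotNr.
have : frobdot (P - M) (P - P') - frobdot (P' - M') (P - P')
     = frob2 (P - P') - frobdot (M - M') (P - P').
  rewrite frob2E !(frobdotC _ (P - P')) -!frobdotNr -!frobdotDr.
  by congr frobdot; apply/matrixP => i j; rewrite !mxE; ring.
lra.
Qed.

(* The competitor is the congruence of [P] by [1 - t N P], [N := P - M]; its
   first-order effect on the objective is [- 2 t |P N|^2]. *)
Lemma psd_proj_complementary n (M P : 'M[R]_n) :
  symmat M -> is_psd_proj M P -> P *m (P - M) = 0.
Proof.
move=> sM [pP minP]; move defN : (P - M) => N.
have sN : N^T = N by rewrite -defN raddfB /= sM pP.1.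
pose A := - (N *m P *m P + P *m P *m N); pose B := N *m P *m P *m P *m N.
apply: (@frob2_eq0 R).
have dotNA : frobdot N A = - (2 * frob2 (P *m N)).
  rewrite frobdotNr frobdotDr frob2E /frobdot sN trmx_mul sN pP.1 !mulmxA.
  rewrite -!mulmxA (mxtrace_mulC N) !mulmxA; ring.
suff: 0 <= 2 * frobdot N A by rewrite dotNA; lra.
(* The constant bounds all terms of order [t ^+ 2] and higher, uniformly for [t <= 1]. *)
apply: (@first_order_ge0 _ (2 * `|frobdot N B| + 2 * frob2 A + 2 * frob2 B)).
move=> t t0 t1.
have /minP := psd_congr (1%:M - t *: (N *m P)) pP.
have -> : (1%:M - t *: (N *m P)) *m P *m (1%:M - t *: (N *m P))^T
   = P + t *: A + t ^+ 2 *: B.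
  have -> : (1%:M - t *: (N *m P))^T = 1%:M - t *: (P *m N).
    by rewrite linearB linearZ /= trmx_mul sN pP.1 trmx1.
  rewrite /A /B.
  rewrite mulmxBl mul1mx mulmxBr mulmx1 !mulmxBl -!scalemxAl -!scalemxAr !mulmxA.
  rewrite scalerA.
  move: (P *m P *m N) (N *m P *m P) (N *m P *m P *m P *m N) => a b c.
  by apply/matrixP => i j; rewrite !mxE; ring.
rewrite -(frob2N (M - P)) -(frob2N (M - (_ + _))) !opprB.
rewrite defN.
have -> : P + t *: A + t ^+ 2 *: B - M = N + t *: (A + t *: B).
  by rewrite scalerDr scalerA -expr2 -defN addrAC [P + _ - M]addrAC -addrA.
have tt1 : t ^+ 2 <= 1 by rewrite expr_le1 // ltW.
have ABt : frob2 (A + t *: B) <= 2 * frob2 A + 2 * frob2 B.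
  have := frob2_ge0 (A - t *: B).
  rewrite !frob2D (frob2N (t *: B)) frobdotNr !frob2Z !frobdotZr.
  have := ler_wpM2r (frob2_ge0 B) tt1; lra.
rewrite frob2D frob2Z frobdotZr frobdotDr frobdotZr.
have t2 := sqr_ge0 t.
have := ler_wpM2l t2 ABt; have := ler_wpM2l t2 (ler_norm (frobdot N B)).
lra.
Qed.

End Projection.

(** * Existence, uniqueness and spectral form of the projection *)

Section Existence.
Variable R : realType.
Local Open Scope classical_set_scope.

Lemma cvgn_sum (I : finType) (u : I -> nat -> R) (a : I -> R) :
  (forall i, u i k @[k --> \oo] --> a i) ->
  (\sum_i u i k) @[k --> \oo] --> \sum_i a i.
Proof. by move=> ua; apply: cvg_big => //; exact: add_continuous. Qed.

(** The cone is closed because symmetry and the sign of each quadratic form survive entrywise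
    limits. *)
Lemma psd_limit n (Y : nat -> 'M[R]_n) (P : 'M[R]_n) :
  (forall k, psd (Y k)) ->
  (forall i j, Y k i j @[k --> \oo] --> P i j) -> psd P.
Proof.
move=> pY cY; split.
  apply/matrixP => i j; rewrite mxE.
  apply: (@cvg_unique _ _ (Y k j i @[k --> \oo])) => //=.
  suff -> : (fun k => Y k j i) = (fun k => Y k i j) by exact: cY.
  by apply: funext => k; have [<- _] := pY k; rewrite mxE (pY k).1.
move=> x.
have E (A : 'M[R]_n) :
    (x^T *m A *m x) 0 0 = \sum_j (\sum_i x^T 0 i * A i j) * x j 0.
  by rewrite mxE; apply: eq_bigr => j _; rewrite mxE.
rewrite E; apply: (@cvgr_to_ge _ \oo _ _
  (fun k => \sum_j (\sum_i x^T 0 i * Y k i j) * x j 0)).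
  apply: cvgn_sum => j; apply: cvgM; last exact: cvg_cst.
  by apply: cvgn_sum => i; apply: cvgM; first exact: cvg_cst.
by apply: nearW => k; rewrite -E; have [_] := pY k; apply.
Qed.

Lemma frob2_limit n (M : 'M[R]_n) (Y : nat -> 'M[R]_n) (P : 'M[R]_n) :
  (forall i j, Y k i j @[k --> \oo] --> P i j) ->
  frob2 (M - Y k) @[k --> \oo] --> frob2 (M - P).
Proof.
have E (A : 'M[R]_n) :
    frob2 (M - A) = \sum_i \sum_j (M i j - A i j) * (M i j - A i j).
  by do 2![apply: eq_bigr => ? _]; rewrite !mxE expr2.
move=> cY; rewrite E.
have -> : (fun k => frob2 (M - Y k)) =
    fun k => \sum_i \sum_j (M i j - Y k i j) * (M i j - Y k i j).
  by apply: funext => k; exact: E.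
apply: cvgn_sum => i; apply: cvgn_sum => j.
by apply: cvgM; apply: cvgB => //; exact: cvg_cst.
Qed.

(** Parallelogram identity. Since midpoints of PSD matrices are PSD, it forces minimizing sequences
    to be Cauchy. *)
Lemma frob2_midpoint n (M X Y : 'M[R]_n) :
  frob2 (X - Y) =
  2 * frob2 (M - X) + 2 * frob2 (M - Y) - 4 * frob2 (M - 2^-1 *: (X + Y)).
Proof.
have -> : X - Y = (M - Y) + - (M - X).
  by rewrite opprB [RHS]addrC addrA subrK.
have -> : M - 2^-1 *: (X + Y) = 2^-1 *: ((M - Y) + (M - X)).
  by apply/matrixP => i j; rewrite !mxE; field.
move: (M - X) (M - Y) => A B.
by rewrite frob2Z !frob2D frob2N frobdotNr (frobdotC B); field.
Qed.

(** Direct method: a minimizing sequence is entrywise Cauchy, and its limit lies in the closed cone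
    and attains the infimum. *)
Lemma psd_proj_exists n (M : 'M[R]_n) : exists P, is_psd_proj M P.
Proof.
pose S := [set frob2 (M - Y) | Y in [set Y | psd Y]].
have S0 : S !=set0 by exists (frob2 (M - 0)), 0 => //; exact: psd0.
have lbS : has_lbound S by exists 0 => _ [Y _ <-]; exact: frob2_ge0.
have dS Y : psd Y -> inf S <= frob2 (M - Y).
  by move=> pY; apply: ge_inf => //; exists Y.
have /choice [Y hY] : forall k : nat, exists Y,
    psd Y /\ frob2 (M - Y) < inf S + k.+1%:R^-1.
  move=> k; have [||_ [Y pY <-] lt] := @inf_adherent _ S k.+1%:R^-1 _ _.
  - by rewrite invr_gt0.
  - by [].
  - by exists Y.
have pY k : psd (Y k) by have [] := hY k.
(* The midpoint has value at least [inf S], so the identity leaves [2/(k+1) + 2/(l+1)], at most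
   [4/(k+1)]. *)
have cauchyY k l i j : (k <= l)%N -> (Y k i j - Y l i j) ^+ 2 <= 4 * k.+1%:R^-1.
  move=> kl; apply: (@le_trans _ _ (frob2 (Y k - Y l))).
    by have := frob2_entry (Y k - Y l) i j; rewrite !mxE.
  rewrite (frob2_midpoint M).
  have : psd (2^-1 *: (Y k + Y l)) by apply: psdZ; [lra | apply: psdD].
  move=> /dS; have [_] := hY k; have [_] := hY l.
  have : (l.+1%:R^-1 : R) <= k.+1%:R^-1 by rewrite lef_pV2 ?posrE // ler_nat.
  move: (_^-1) (_^-1) => a b.
  lra.
have cvgY i j : cvg (Y k i j @[k --> \oo]).
  apply/cauchy_cvgP/cauchy_exP => e e0.
  have e2 : 0 < e ^+ 2 / 4 by rewrite divr_gt0 // exprn_gt0.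
  have [N _ /(_ N (leqnn N)) /= hN] := near_infty_natSinv_lt (PosNum e2).
  exists (Y N i j), N => //= l Nl; rewrite /ball /= -ltr_sqr ?nnegrE ?(ltW e0) //.
  rewrite real_normK ?num_real //; apply: le_lt_trans (cauchyY _ _ _ _ Nl) _.
  by rewrite mulrC -ltr_pdivlMr.
pose P : 'M[R]_n := \matrix_(i, j) lim (Y k i j @[k --> \oo]).
have cY i j : Y k i j @[k --> \oo] --> P i j by rewrite mxE; exact: cvgY.
exists P; split; first exact: psd_limit cY.
move=> X pX; apply: le_trans (dS _ pX).
have cd : (inf S + k.+1%:R^-1) @[k --> \oo] --> inf S + 0.
  by apply: cvgD; [exact: cvg_cst | exact: cvg_harmonic].
rewrite -[leRHS]addr0; apply: ler_cvg_to (frob2_limit cY) cd _.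
by apply: nearW => k; apply/ltW; have [] := hY k.
Qed.

(** Existence guarantees that [xget] does not fall back on its default 0. *)
Lemma psd_projP n (M : 'M[R]_n) : is_psd_proj M (psd_proj M).
Proof. by rewrite /psd_proj; apply: xgetPex; exact: psd_proj_exists. Qed.

(** Uniqueness is nonexpansiveness applied to two projections of the same matrix. *)
Lemma psd_proj_eq n (M P : 'M[R]_n) : is_psd_proj M P -> psd_proj M = P.
Proof.
move=> hP; apply/eqP; rewrite -subr_eq0; apply/eqP/frob2_eq0.
apply: le_trans (psd_proj_nonexpansive (psd_projP M) hP) _.
by rewrite subrr /frob2 big1 // => i _; rewrite big1 // => j _; rewrite mxE expr0n.
Qed.

(** Moreau decomposition: the difference [P - Z] carries the negative parts of [d]. It is orthogonal
    to [P], since at each index the positive or the negative part vanishes, and has nonnegative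
    inner product with every PSD [Y]. *)
Lemma psd_proj_spectral n (Q : 'M[R]_n) (d : 'rV[R]_n) :
  Q^T *m Q = 1%:M ->
  psd_proj (Q *m diag_mx d *m Q^T)
    = Q *m diag_mx (\row_i Num.max (d 0 i) 0) *m Q^T.
Proof.
move=> QQ; pose dp : 'rV[R]_n := \row_i Num.max (d 0 i) 0.
pose dn := dp - d.
have dn0 i : 0 <= dn 0 i by rewrite !mxE subr_ge0 le_max lexx.
apply: psd_proj_eq; rewrite -/dp; split.
  by apply/psd_congr/psd_diag => i; rewrite mxE le_max lexx orbT.
move=> Y pY; set Z := Q *m diag_mx d *m Q^T; set P := Q *m diag_mx dp *m Q^T.
have defN : P - Z = Q *m diag_mx dn *m Q^T.
  by rewrite /dn (raddfB diag_mx) mulmxBr mulmxBl.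
have dotN (W : 'M[R]_n) : frobdot (P - Z) W = \sum_i dn 0 i * (Q^T *m W *m Q) i i.
  rewrite defN /frobdot !trmx_mul trmxK tr_diag_mx -!mulmxA mxtrace_mulC -!mulmxA.
  by rewrite mul_diag_mx /mxtrace; apply: eq_bigr => i _; rewrite mxE mulmxA.
have NP : frobdot (P - Z) P = 0.
  rewrite dotN big1 // => i _.
  rewrite /P !mulmxA QQ mul1mx -mulmxA QQ mulmx1 !mxE eqxx mulr1n.
  by case: ltgtP => [| |->]; rewrite ?subrr ?mul0r ?mulr0 ?subr0 // subrr mul0r.
have NY : 0 <= frobdot (P - Z) Y.
  rewrite dotN; apply: sumr_ge0 => i _; apply: mulr_ge0 => //.
  apply: psd_diag_ge0; rewrite -[X in _ *m X]trmxK; exact: psd_congr.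
have -> : Z - Y = - ((P - Z) + (Y - P)).
  by rewrite opprD !opprB [_ + (P - Y)]addrA subrK.
rewrite -(opprB P Z) !frob2N (frob2D (P - Z)) frobdotDr frobdotNr NP.
have := frob2_ge0 (Y - P); lra.
Qed.

End Existence.

(** * Blockwise perturbation estimates *)

Section Perturbation.
Variable R : realType.

(** Serves to invert diagonal scalings and diagonal Sylvester operators entry by entry. *)
Lemma l1norm_dominated m n (X W : 'M[R]_(m, n)) (delta : R) :
  0 <= delta -> (forall i j, delta * `|X i j| <= `|W i j|) ->
  delta * l1norm X <= l1norm W.
Proof.
move=> d0 XW; rewrite /l1norm mulr_sumr; apply: ler_sum => i _.
by rewrite mulr_sumr; apply: ler_sum.
Qed.

Lemma hadamard_block m1 m2 n1 n2 (A A' : 'M[R]_(m1, n1)) (B B' : 'M_(m1, n2))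
    (C C' : 'M_(m2, n1)) (D D' : 'M_(m2, n2)) :
  hadamard (block_mx A B C D) (block_mx A' B' C' D') =
  block_mx (hadamard A A') (hadamard B B') (hadamard C C') (hadamard D D').
Proof.
apply/matrixP => i j; rewrite mxE -(splitK i) -(splitK j).
case: (split i) => i'; case: (split j) => j' /=;
by rewrite ?block_mxEul ?block_mxEur ?block_mxEdl ?block_mxEdr mxE.
Qed.

Lemma psd_part_block r s (lam : 'rV[R]_(r + s)) :
  (forall j : 'I_r, 0 < lam 0 (lshift s j)) ->
  (forall i : 'I_s, lam 0 (rshift r i) < 0) ->
  diag_mx (\row_i Num.max (lam 0 i) 0) = block_mx (diag_mx (lsubmx lam)) 0 0 0.
Proof.
move=> lp ln; set d := (\row_i _).
have -> : d = row_mx (lsubmx lam) 0.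
  apply/rowP => k; rewrite -(splitK k) mxE; case: (split k) => k' /=.
    by rewrite row_mxEl mxE; apply/max_idPl/ltW.
  by rewrite row_mxEr mxE; apply/max_idPr/ltW.
by rewrite diag_mx_row raddf0.
Qed.

(** The three equations are the upper-left block of [P (P - M) = 0] and the two lower blocks of
    [(P - M) P = 0]; [T] solves the unperturbed Sylvester equation. The condition [8 * e <= delta]
    lets error terms containing the unknown be absorbed on the left, and [kappa] is the constant in
    [|X| <= kappa |B|]. *)
Lemma block_perturbation r s (a : 'rV[R]_r) (c : 'rV[R]_s)
    (P11 K11 : 'M[R]_r) (X B T : 'M[R]_(s, r)) (P22 K22 : 'M[R]_s) (delta e : R) :
  0 < delta -> (forall j, delta <= a 0 j) -> (forall i, delta <= - c 0 i) ->
  8 * e <= delta ->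
  l1norm (P11 - diag_mx a) <= e -> l1norm X <= e -> l1norm P22 <= e ->
  l1norm K22 <= e ->
  P11 *m (P11 - diag_mx a - K11) + X^T *m (X - B) = 0 ->
  (X - B) *m P11 + (P22 - diag_mx c - K22) *m X = 0 ->
  (X - B) *m X^T + (P22 - diag_mx c - K22) *m P22 = 0 ->
  (forall i j, (a 0 j - c 0 i) * T i j = a 0 j * B i j) ->
  let kappa := 2 * (l1norm (diag_mx a) / delta + 1) in
  [/\ delta * l1norm (P11 - diag_mx a - K11) <= 2 * (kappa + 1) * l1norm B * e,
      delta * l1norm (X - T) <= (1 + 3 * kappa) * l1norm B * e
    & delta * l1norm P22 <= 2 * (kappa + 1) * l1norm B * e].
Proof.
move=> d0 ha hc he.
have -> : P11 = diag_mx a + (P11 - diag_mx a) by rewrite addrC subrK.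
rewrite [diag_mx a + _ - _]addrC addKr; move: (P11 - _) => E1.
move=> hE1 hX hP hK; rewrite (addrAC P22).
have hE2 : l1norm (P22 - K22) <= 2 * e.
  by apply: le_trans (l1normB _ _) _; lra.
move: (P22 - K22) hE2 => E2 hE2 eq11 eq21 eq22 hT kappa.
set b := l1norm B; set x := l1norm X; set L := l1norm (diag_mx a).
have b0 : 0 <= b := l1norm_ge0 B.
have x0 : 0 <= x := l1norm_ge0 X.
have L0 : 0 <= L := l1norm_ge0 (diag_mx a).
have e0 : 0 <= e := le_trans x0 hX.
have p0 := l1norm_ge0 P22.
have n0 := l1norm_ge0 (E1 - K11).
have kd : kappa * delta = 2 * (L + delta).
  by rewrite /kappa -/L; field; rewrite gt_eqF.
have hXB : l1norm (X - B) <= x + b by apply: l1normB.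
(* The second-order part of the lower-left equation; what remains is a Sylvester equation with
   diagonal coefficients. *)
pose W := (B - X) *m E1 - E2 *m X.
have hW : l1norm W <= (x + b) * e + 2 * e * x.
  apply: le_trans (l1normB _ _) _; apply: lerD.
    apply: le_trans (l1normM _ _) _; apply: ler_pM => //;
    rewrite ?l1norm_ge0 // -(opprB X B) l1normN //.
  by apply: le_trans (l1normM _ _) _; apply: ler_pM; rewrite ?l1norm_ge0.
have eqW : X *m diag_mx a - diag_mx c *m X = B *m diag_mx a + W.
  move: eq21; rewrite /W !mulmxDr !mulmxDl !mulNmx.
  move: (X *m diag_mx a) (X *m E1) (B *m diag_mx a) (B *m E1) (E2 *m X)
    (diag_mx c *m X) => m1 m2 m3 m4 m5 m6 /matrixP h.
  by apply/matrixP => i j; move: (h i j); rewrite !mxE; lra.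
move: W hW eqW => W hW eqW.
have eqX i j : (a 0 j - c 0 i) * X i j = a 0 j * B i j + W i j.
  move/matrixP: eqW => /(_ i j).
  by rewrite !mul_mx_diag mul_diag_mx !mxE; lra.
have gap i j : delta <= a 0 j - c 0 i by have := ha j; have := hc i; lra.
have gapM i j u v : (a 0 j - c 0 i) * u = v -> delta * `|u| <= `|v|.
  move=> <-; rewrite normrM ler_wpM2r // (le_trans (gap i j)) // ler_norm.
  by [].
(* The terms [3 * e * x] from [W] are at most [3/8] of [delta * x] and move to the left. *)
have xk : x <= kappa * b.
  have : delta * x <= l1norm (B *m diag_mx a + W).
    apply: l1norm_dominated => [|i j]; first exact: ltW.
    by apply: (gapM i j); rewrite eqX mul_mx_diag !mxE; ring.
  have := l1normD (B *m diag_mx a) W.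
  have := l1normM B (diag_mx a); rewrite -/b -/L => h1 h2 h3.
  rewrite -(ler_pM2l d0).
  have -> : delta * (kappa * b) = 2 * (L + delta) * b by rewrite -kd; ring.
  have : 8 * e * x <= delta * x by apply: ler_wpM2r.
  have : 8 * e * b <= delta * b by apply: ler_wpM2r.
  have : 0 <= L * b by apply: mulr_ge0.
  have : 0 <= delta * b by rewrite mulr_ge0 // ltW.
  lra.
(* One factor is measured against [b] and the other against [e], which keeps the bound linear in the
   off-diagonal block. *)
have xbx : (x + b) * x <= (kappa + 1) * b * e.
  apply: ler_pM => //; first exact: addr_ge0.
  lra.
split.
(* The equation is solved for [diag_mx a *m (E1 - K11)]; the term with [E1] costs at most an eighth
   of the left side. *)
- have : delta * l1norm (E1 - K11) <= l1norm (- (E1 *m (E1 - K11)) - X^T *m (X - B)).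
    have -> : - (E1 *m (E1 - K11)) - X^T *m (X - B) = diag_mx a *m (E1 - K11).
      apply/eqP; rewrite -opprD eq_sym -addr_eq0 addrA -mulmxDl; exact/eqP.
    apply: l1norm_dominated => [|i j]; first exact: ltW.
    rewrite mul_diag_mx !mxE normrM ler_wpM2r //.
    exact: le_trans (ha i) (ler_norm _).
  have := l1normB (- (E1 *m (E1 - K11))) (X^T *m (X - B)); rewrite l1normN.
  have := l1normM E1 (E1 - K11).
  have := l1normM X^T (X - B); rewrite l1norm_tr -/x.
  have : l1norm E1 * l1norm (E1 - K11) <= e * l1norm (E1 - K11) by apply: ler_wpM2r.
  have : x * l1norm (X - B) <= x * (x + b) by apply: ler_wpM2l.
  have := ler_wpM2r n0 he; have := mulr_ge0 (ltW d0) n0.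
  lra.
(* Subtracting the equation of [T] cancels [B *m diag_mx a] and leaves only [W]. *)
- have : delta * l1norm (X - T) <= l1norm W.
    apply: l1norm_dominated => [|i j]; first exact: ltW.
    by apply: (gapM i j); rewrite !mxE mulrBr eqX hT; ring.
  have := ler_wpM2r e0 xk.
  rewrite -/b; lra.
(* Likewise with [- diag_mx c]; here [E2] costs at most a quarter of the left side. *)
- have : delta * l1norm P22 <= l1norm (- (E2 *m P22) - (X - B) *m X^T).
    have -> : - (E2 *m P22) - (X - B) *m X^T = - diag_mx c *m P22.
      move: eq22; rewrite (mulmxBl E2) mulNmx.
      move: (_ *m X^T) (E2 *m _) (diag_mx c *m _) => m1 m2 m3 /matrixP h.
      by apply/matrixP => i j; move: (h i j); rewrite !mxE; lra.
    apply: l1norm_dominated => [|i j]; first exact: ltW.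
    rewrite mulNmx mul_diag_mx !mxE normrN normrM ler_wpM2r // -normrN.
    exact: le_trans (hc i) (ler_norm _).
  have := l1normB (- (E2 *m P22)) ((X - B) *m X^T); rewrite l1normN.
  have := l1normM E2 P22.
  have := l1normM (X - B) X^T; rewrite l1norm_tr -/x.
  have : l1norm E2 * l1norm P22 <= 2 * e * l1norm P22 by apply: ler_wpM2r.
  have : l1norm (X - B) * x <= (x + b) * x by apply: ler_wpM2r.
  have := ler_wpM2r p0 he; have := mulr_ge0 (ltW d0) p0.
  lra.
Qed.

(** The inverse of one plus the sum of all [1/|d_i|] replaces a minimum; the added 1 covers
    [n = 0]. *)
Lemma exists_spectral_gap n (d : 'rV[R]_n) :
  (forall i, d 0 i != 0) ->
  exists2 delta : R, 0 < delta & forall i, delta <= `|d 0 i|.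
Proof.
move=> dn0; pose S := \sum_i `|d 0 i|^-1.
have S0 : 0 <= S by apply: sumr_ge0 => i _; rewrite invr_ge0.
have S1 : 0 < 1 + S by lra.
exists (1 + S)^-1 => [|i]; first by rewrite invr_gt0.
rewrite -[leRHS]invrK lef_pV2 ?posrE ?invr_gt0 ?normr_gt0 //.
rewrite /S (bigD1 i) //= addrCA lerDl addr_ge0 //.
by apply: sumr_ge0 => k _; rewrite invr_ge0.
Qed.

End Perturbation.

(** * The full estimate in the eigenbasis of [Z] *)

Section Rotated.
Variable R : realType.

Lemma complementary_perturbation r s (lam : 'rV[R]_(r + s)) (delta : R) :
  0 < delta ->
  (forall j : 'I_r, delta <= lam 0 (lshift s j)) ->
  (forall i : 'I_s, delta <= - lam 0 (rshift r i)) ->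
  exists2 C : R, 0 <= C & forall (P K : 'M[R]_(r + s)) e,
    symmat P -> symmat K -> P *m (P - (diag_mx lam + K)) = 0 ->
    8 * e <= delta -> l1norm K <= e ->
    l1norm (P - diag_mx (\row_i Num.max (lam 0 i) 0)) <= e ->
    l1norm (P - diag_mx (\row_i Num.max (lam 0 i) 0) - hadamard (Omega lam) K)
      <= C * l1norm (dlsubmx K) * e.
Proof.
move=> d0 ha hc; set a := lsubmx lam; set c := rsubmx lam.
pose kappa := 2 * (l1norm (diag_mx a) / delta + 1).
have k0 : 0 <= kappa.
  by rewrite mulr_ge0 // addr_ge0 // divr_ge0 ?l1norm_ge0 // ltW.
(* Two diagonal blocks contribute [2 * (kappa + 1)] each, and the off-diagonal block and its
   transpose [1 + 3 * kappa] each. *)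
exists ((4 * (kappa + 1) + 2 * (1 + 3 * kappa)) / delta).
  by rewrite divr_ge0 ?(ltW d0) //; lra.
move=> P K e sP sK PN he hK hP.
(* Both factors are symmetric, so transposition reverses the product. *)
have NP : (P - (diag_mx lam + K)) *m P = 0.
  have sN : (P - (diag_mx lam + K))^T = P - (diag_mx lam + K).
    by rewrite raddfB /= raddfD /= sP tr_diag_mx sK.
  by apply: trmx_inj; rewrite trmx_mul sN sP trmx0.
rewrite psd_part_block in hP *; last 2 first.
- by move=> j; apply: lt_le_trans (ha j).
- by move=> i; have := hc i; lra.
rewrite -/a in hP *.
have Elam : diag_mx lam = block_mx (diag_mx a) 0 0 (diag_mx c).
  by rewrite -diag_mx_row hsubmxK.
have EP : P = block_mx (ulsubmx P) (dlsubmx P)^T (dlsubmx P) (drsubmx P).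
  by rewrite trmx_dlsub sP submxK.
have EK : K = block_mx (ulsubmx K) (dlsubmx K)^T (dlsubmx K) (drsubmx K).
  by rewrite trmx_dlsub sK submxK.
move: hK hP PN NP; rewrite EP EK Elam /Omega block_mxKdl.
move: (ulsubmx P) (dlsubmx P) (drsubmx P) => P11 X P22.
move: (ulsubmx K) (dlsubmx K) (drsubmx K) => K11 B K22.
rewrite hadamard_block !opp_block_mx !add_block_mx !opp_block_mx !add_block_mx.
rewrite !mulmx_block !oppr0 !addr0 !add0r.
rewrite !opprD !addrA => hK hP /eqP; rewrite block_mx_eq0.
move=> /and4P[/eqP eq11 _ _ _] /eqP; rewrite block_mx_eq0.
move=> /and4P[_ _ /eqP eq21 /eqP eq22].
have -> : hadamard (const_mx 1) K11 = K11.
  by apply/matrixP => i j; rewrite !mxE mul1r.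
have -> : hadamard 0 K22 = 0.
  by apply/matrixP => i j; rewrite !mxE mul0r.
have -> : hadamard (Theta lam)^T B^T = (hadamard (Theta lam) B)^T.
  by apply/matrixP => i j; rewrite !mxE.
rewrite -linearB subr0 /=.
move: hK hP; rewrite !l1norm_block !l1norm_tr.
have := l1norm_ge0 K11; have := l1norm_ge0 B; have := l1norm_ge0 K22.
have := l1norm_ge0 (P11 - diag_mx a); have := l1norm_ge0 X.
have := l1norm_ge0 P22 => p22 x0 p11 k22 b0 k11 hK hP.
have ha' j : delta <= a 0 j by rewrite mxE.
have hc' i : delta <= - c 0 i by rewrite mxE.
(* The entries of [Theta] are exactly the coefficients that solve the Sylvester equation with
   right-hand side [B *m diag_mx a]. *)
have hT i j : (a 0 j - c 0 i) * hadamard (Theta lam) B i j = a 0 j * B i j.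
  have gap : 0 < lam 0 (lshift s j) - lam 0 (rshift r i).
    by have := ha j; have := hc i; lra.
  by rewrite !mxE; field; rewrite gt_eqF.
have [||||b11 b21 b22] :=
  block_perturbation d0 ha' hc' he _ _ _ _ eq11 eq21 eq22 hT; try lra.
rewrite -(ler_pM2l d0).
have -> : delta * ((4 * (kappa + 1) + 2 * (1 + 3 * kappa)) / delta * l1norm B * e)
    = (4 * (kappa + 1) + 2 * (1 + 3 * kappa)) * l1norm B * e.
  by field; rewrite gt_eqF.
move: b11 b21 b22; rewrite -/kappa; lra.
Qed.

End Rotated.

(** * Return to the original basis and to the spectral norm *)

Lemma psd_proj_l1_lipschitz (R : realType) n (M M' : 'M[R]_n) :
  l1norm (psd_proj M - psd_proj M') <= (n * n)%:R * l1norm (M - M').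
Proof.
set D := _ - psd_proj M'.
(* Each entry is bounded through the Frobenius norm, which the projection does not increase;
   counting entries gives [n * n]. *)
apply: (@le_trans _ _ (\sum_(i < n) \sum_(j < n) l1norm (M - M'))).
  do 2![apply: ler_sum => ? _].
  rewrite -ler_sqr ?nnegrE ?l1norm_ge0 // real_normK ?num_real //.
  apply: le_trans (frob2_entry _ _ _) _; apply: le_trans (frob2_le_l1norm _).
  by apply: psd_proj_nonexpansive; apply: psd_projP.
by rewrite !sumr_const !card_ord -mulrnA mulr_natl.
Qed.

Theorem theorem2 (R : realType) (r s : nat) (Z Q : 'M[R]_(r + s))
    (lam : 'rV[R]_(r + s)) :
  symmat Z ->
  Z \in unitmx ->
  Q^T *m Q = 1%:M ->
  Z = Q *m diag_mx lam *m Q^T ->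
  (forall i j : 'I_(r + s), (i <= j)%N -> lam 0 j <= lam 0 i) ->
  (forall j : 'I_r, 0 < lam 0 (lshift s j)) ->
  (forall i : 'I_s, lam 0 (rshift r i) < 0) ->
  exists C_EB alpha_EB : R, 0 < C_EB /\ 0 < alpha_EB /\
    forall H : 'M[R]_(r + s), symmat H -> specnorm H <= C_EB ->
      let Ht := Q^T *m H *m Q in
      specnorm (psd_proj (Z + H) - psd_proj Z - Q *m hadamard (Omega lam) Ht *m Q^T)
        <= alpha_EB * specnorm (dlsubmx Ht) * specnorm H.
Proof.
move=> sZ _ QQ defZ _ lp ln.
have QQt : Q *m Q^T = 1%:M by apply: mulmx1C.
have [|delta d0 hdelta] := @exists_spectral_gap R (r + s) lam.
  move=> i; rewrite -(splitK i).
  by case: (split i) => k /=; [rewrite gt_eqF | rewrite lt_eqF].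
have [||C C0 hC] := @complementary_perturbation R r s lam delta d0.
- by move=> j; have := hdelta (lshift s j); rewrite gtr0_norm.
- by move=> i; have := hdelta (rshift r i); rewrite ltr0_norm.
pose q := l1norm Q; pose N : R := ((r + s) * (r + s))%:R.
have q0 : 0 <= q := l1norm_ge0 Q.
have N0 : 0 <= N by apply: ler0n.
(* Chosen so that [e := g * h] bounds both [K] and the projection error: conjugation costs [q * q],
   norm equivalence [N], and the Lipschitz bound another [N]. *)
move defg : (q * q * (N + 1) * N) => g.
have g0 : 0 <= g by rewrite -defg !mulr_ge0 // addr_ge0.
(* The radius ensures [8 * (g * h) <= delta], with [g + 1] avoiding a zero denominator. In the
   second constant [q * q] pays for rotating back, [(s * r)%:R] for the norm of the off-diagonal
   block, and the final 1 gives positivity. *)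
exists (delta / (8 * (g + 1))), (q * q * C * g * (s * r)%:R + 1).
split; first by rewrite divr_gt0 // mulr_gt0 // ltr_wpDl.
split; first by rewrite ltr_wpDl // !mulr_ge0.
move=> H sH hH; set K := Q^T *m H *m Q; rewrite /= -/K; set h := specnorm H in hH *.
have h0 : 0 <= h by apply: specnorm_ge0.
have hN : l1norm H <= N * h by apply: l1norm_le_specnorm.
have conj_le (A B W : 'M[R]_(r + s)) :
    l1norm A = q -> l1norm B = q -> l1norm (A *m W *m B) <= q * q * l1norm W.
  move=> Aq Bq; apply: le_trans (l1normM _ _) _; rewrite Bq mulrAC ler_wpM2r //.
  by rewrite -Aq l1normM.
have qt : l1norm Q^T = q by rewrite l1norm_tr.
set Pi := psd_proj (Z + H); pose P := Q^T *m Pi *m Q.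
have sZH : symmat (Z + H) by rewrite /symmat raddfD /= sZ sH.
have [sPi _] := (psd_projP (Z + H)).1.
have DK : Q^T *m (Z + H) *m Q = diag_mx lam + K.
  rewrite mulmxDr mulmxDl defZ !mulmxA QQ mul1mx -mulmxA QQ mulmx1 //.
have Dp : Q^T *m psd_proj Z *m Q = diag_mx (\row_i Num.max (lam 0 i) 0).
  by rewrite defZ psd_proj_spectral // !mulmxA QQ mul1mx -mulmxA QQ mulmx1.
have hT : l1norm (P - diag_mx (\row_i Num.max (lam 0 i) 0)
    - hadamard (Omega lam) K) <= C * l1norm (dlsubmx K) * (g * h).
  apply: hC.
  - by rewrite /symmat /P !trmx_mul trmxK sPi mulmxA.
  - by rewrite /symmat /K !trmx_mul trmxK sH mulmxA.
  (* Conjugation by [Q] carries the complementarity of the projection of [Z + H] to the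
     eigenbasis. *)
  - rewrite -DK /P -mulmxBl -mulmxBr !mulmxA -(mulmxA _ Q) QQt mulmx1.
    rewrite -(mulmxA _ Pi) psd_proj_complementary ?mulmx0 ?mul0mx //.
    exact: psd_projP.
  - move: hH; rewrite ler_pdivlMr ?mulr_gt0 ?ltr_wpDl // => hH.
    by apply: le_trans hH; lra.
  - apply: le_trans (conj_le _ _ _ qt (erefl _)) _.
    apply: (@le_trans _ _ (q * q * (N * h))); first by rewrite ler_wpM2l // mulr_ge0.
    have : 0 <= q * q * (N * h) * N by rewrite !mulr_ge0.
    rewrite -defg; lra.
  - rewrite -Dp /P -mulmxBl -mulmxBr.
    apply: le_trans (conj_le _ _ _ qt (erefl _)) _.
    have := psd_proj_l1_lipschitz (Z + H) Z; rewrite addrAC subrr add0r -/N -/Pi.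
    move=> hD; have hD' := le_trans hD (ler_wpM2l N0 hN).
    apply: le_trans (ler_wpM2l (mulr_ge0 q0 q0) hD') _.
    have : 0 <= q * q * (N * h) by rewrite !mulr_ge0.
    rewrite -defg; lra.
have -> : Pi - psd_proj Z - Q *m hadamard (Omega lam) K *m Q^T =
    Q *m (P - diag_mx (\row_i Num.max (lam 0 i) 0) - hadamard (Omega lam) K) *m Q^T.
  rewrite -Dp /P 2!mulmxBr 2!mulmxBl !mulmxA QQt !mul1mx.
  by rewrite -!mulmxA QQt !mulmx1 !mulmxA.
apply: le_trans (specnorm_le_l1norm _) _.
apply: le_trans (conj_le _ _ _ (erefl _) qt) _.
apply: le_trans (ler_wpM2l (mulr_ge0 q0 q0) hT) _.
have hO : l1norm (dlsubmx K) <= (s * r)%:R * specnorm (dlsubmx K).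
  exact: l1norm_le_specnorm.
have : 0 <= specnorm (dlsubmx K) * h by rewrite mulr_ge0 // specnorm_ge0.
have : 0 <= q * q * C * g * h by rewrite !mulr_ge0.
move=> /ler_wpM2l /(_ _ _ hO).
move: (l1norm (dlsubmx K)) (specnorm (dlsubmx K)) ((s * r)%:R) => *; lra.
Qed.
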